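(* Let $(E,\rho)\colon\mathcal{C}\to\mathcal{C}'$ be a $G$-equivariant functor in $G\text{-}\mathbf{Cat}$ (i.e. between small $G$-categories). Then the following are equivalent: (1) $(E,\rho)$ is an equivalence in the $2$-category $G\text{-}\mathbf{Cat}$; (2) $E$ is fully faithful and dense (i.e. $E$ is an equivalence of categories). Thus the $G$-equivariant equivalences (the $G$-equivariant functors whose underlying functor is an equivalence of categories) are exactly the equivalences in $G\text{-}\mathbf{Cat}$.
   Context: Throughout, $G$ is a group, $\Bbbk$ is a commutative ring, and all categories and functors are $\Bbbk$-linear. A $G$-category is a $\Bbbk$-category $\mathcal{C}$ with a group homomorphism $A\colon G\to\operatorname{Aut}(\mathcal{C})$, $a\mapsto A_a$ (all actions are denoted by $A$). A $G$-equivariant functor $\mathcal{C}\to\mathcal{C}'$ is a pair $(E,\rho)$ of a $\Bbbk$-functor $E\colon\mathcal{C}\to\mathcal{C}'$ and a family $\rho=(\rho_a)_{a\in G}$ of natural isomorphisms $\rho_a\colon A_aE\Rightarrow EA_a$ with $\rho_{ba}=(\rho_bA_a)\circ(A_b\rho_a)$ for all $a,b\in G$. A morphism $(E,\rho)\to(E',\rho')$ is a natural transformation $\eta\colon E\Rightarrow E'$ with $(\eta A_a)\circ\rho_a=\rho'_a\circ(A_a\eta)$ for all $a\in G$. The composite is $(E',\rho')(E,\rho)=(E'E,((E'\rho_a)(\rho'_aE))_{a\in G})$. The 2-category $G\text{-}\mathbf{Cat}$ has small $G$-categories as objects, $G$-equivariant functors as 1-morphisms, and morphisms of $G$-equivariant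 functors as 2-morphisms, with identity 1-morphisms $(\mathrm{id}_{\mathcal{C}},(\mathrm{id})_{a\in G})$ and the usual vertical and horizontal compositions of natural transformations. A functor is dense if every object of the target is isomorphic to an object in its image. *)

(* Defs.v *)
From mathcomp Require Import all_boot all_algebra.
From mathcomp Require Import boolp.

Set Implicit Arguments.
Unset Strict Implicit.
Unset Printing Implicit Defensive.

Import GRing.Theory.
Local Open Scope ring_scope.

Declare Scope lincat_scope.
Delimit Scope lincat_scope with LC.
Local Open Scope lincat_scope.

(** * Strict 2-categories and their equivalences *)

(* The laws hcompA, hcomp1l, hcomp1r relate 2-morphisms whose boundaries are  *)
(* equal but not convertible. They are stated as equalities in the type of    *)
(* all 2-morphisms x => y, i.e., boundaries included.                         *)
Record cell2 (T1 : Type) (T2 : T1 -> T1 -> Type) : Type := Cell2 {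
  cell2_src : T1;
  cell2_tgt : T1;
  cell2_mor : T2 cell2_src cell2_tgt
}.
Arguments Cell2 {T1 T2 cell2_src cell2_tgt} cell2_mor.

Record twocat : Type := TwoCat {
  mor0 :> Type;
  mor1 : mor0 -> mor0 -> Type;
  mor2 : forall x y, mor1 x y -> mor1 x y -> Type;
  id1 : forall x, mor1 x x;
  comp1 : forall x y z, mor1 y z -> mor1 x y -> mor1 x z;
  id2 : forall x y (f : mor1 x y), mor2 f f;
  vcomp : forall x y (f g h : mor1 x y), mor2 g h -> mor2 f g -> mor2 f h;
  hcomp : forall x y z (f f' : mor1 x y) (g g' : mor1 y z),
    mor2 g g' -> mor2 f f' -> mor2 (comp1 g f) (comp1 g' f');
  vcompA : forall x y (f g h k : mor1 x y)
      (c : mor2 h k) (b : mor2 g h) (a : mor2 f g),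
    vcomp c (vcomp b a) = vcomp (vcomp c b) a;
  vcomp1l : forall x y (f g : mor1 x y) (a : mor2 f g), vcomp (id2 g) a = a;
  vcomp1r : forall x y (f g : mor1 x y) (a : mor2 f g), vcomp a (id2 f) = a;
  hcomp_id2 : forall x y z (f : mor1 x y) (g : mor1 y z),
    hcomp (id2 g) (id2 f) = id2 (comp1 g f);
  interchange : forall x y z (f f' f'' : mor1 x y) (g g' g'' : mor1 y z)
      (b' : mor2 g' g'') (b : mor2 g g') (a' : mor2 f' f'') (a : mor2 f f'),
    hcomp (vcomp b' b) (vcomp a' a) = vcomp (hcomp b' a') (hcomp b a);
  comp1A : forall x y z t (h : mor1 z t) (g : mor1 y z) (f : mor1 x y),
    comp1 h (comp1 g f) = comp1 (comp1 h g) f;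
  comp11l : forall x y (f : mor1 x y), comp1 (id1 y) f = f;
  comp11r : forall x y (f : mor1 x y), comp1 f (id1 x) = f;
  hcompA : forall x y z t (f f' : mor1 x y) (g g' : mor1 y z) (h h' : mor1 z t)
      (c : mor2 h h') (b : mor2 g g') (a : mor2 f f'),
    Cell2 (hcomp c (hcomp b a)) = Cell2 (hcomp (hcomp c b) a);
  hcomp1l : forall x y (f f' : mor1 x y) (a : mor2 f f'),
    Cell2 (hcomp (id2 (id1 y)) a) = Cell2 a;
  hcomp1r : forall x y (f f' : mor1 x y) (a : mor2 f f'),
    Cell2 (hcomp a (id2 (id1 x))) = Cell2 a
}.

Definition iso1 (K : twocat) (x y : K) (f g : mor1 x y) : Prop :=
  exists (a : mor2 f g) (b : mor2 g f),
    vcomp b a = id2 f /\ vcomp a b = id2 g.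

Definition is_equivalence (K : twocat) (x y : K) (f : mor1 x y) : Prop :=
  exists g : mor1 y x,
    iso1 (comp1 g f) (id1 x) /\ iso1 (comp1 f g) (id1 y).

(** * Linear categories, functors and natural transformations *)

Record lincat (k : comPzRingType) : Type := LinCat {
  obj :> Type;
  hom : obj -> obj -> lmodType k;
  idm : forall x, hom x x;
  comp : forall x y z, hom y z -> hom x y -> hom x z;
  compA : forall x y z t (h : hom z t) (g : hom y z) (f : hom x y),
    comp h (comp g f) = comp (comp h g) f;
  comp1m : forall x y (f : hom x y), comp (idm y) f = f;
  compm1 : forall x y (f : hom x y), comp f (idm x) = f;
  comp_linearl : forall x y z (f : hom x y),
    linear (fun g : hom y z => comp g f);
  comp_linearr : forall x y z (g : hom y z),
    linear (fun f : hom x y => comp g f)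
}.

Notation "g ∘ f" := (comp g f) (at level 40, left associativity) : lincat_scope.

Record linfunctor (k : comPzRingType) (C D : lincat k) : Type := LinFunctor {
  fobj :> C -> D;
  fmap : forall x y : C, hom x y -> hom (fobj x) (fobj y);
  fmap_linear : forall x y : C, linear (@fmap x y);
  fmap1 : forall x : C, fmap (idm x) = idm (fobj x);
  fmapM : forall (x y z : C) (g : hom y z) (f : hom x y),
    fmap (g ∘ f) = fmap g ∘ fmap f
}.
Arguments fmap {k C D} l {x y} f.

Record nattrans (k : comPzRingType) (C D : lincat k) (E F : linfunctor C D)
    : Type := NatTrans {
  cmp :> forall x : C, hom (E x) (F x);
  cmp_nat : forall (x y : C) (f : hom x y),
    cmp y ∘ fmap E f = fmap F f ∘ cmp x
}.

Definition is_iso (k : comPzRingType) (C : lincat k) (x y : C) (f : hom x y)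
    : Prop :=
  exists g : hom y x, g ∘ f = idm x /\ f ∘ g = idm y.

Definition isomorphic (k : comPzRingType) (C : lincat k) (x y : C) : Prop :=
  exists f : hom x y, is_iso f.

Definition is_natiso (k : comPzRingType) (C D : lincat k)
    (E F : linfunctor C D) (eta : nattrans E F) : Prop :=
  forall x, is_iso (eta x).

Definition fully_faithful (k : comPzRingType) (C D : lincat k)
    (E : linfunctor C D) : Prop :=
  forall x y : C, bijective (@fmap k C D E x y).

Definition dense (k : comPzRingType) (C D : lincat k)
    (E : linfunctor C D) : Prop :=
  forall y : D, exists x : C, isomorphic (E x) y.

Definition idfun_lin (k : comPzRingType) (C : lincat k) : linfunctor C C :=
  @LinFunctor k C C (fun x => x) (fun _ _ f => f)
    (fun _ _ _ _ _ => erefl) (fun _ => erefl) (fun _ _ _ _ _ => erefl).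

Section FunctorComposition.
Context (k : comPzRingType) (B C D : lincat k).
Context (F : linfunctor C D) (E : linfunctor B C).

Lemma compf_linear (x y : B) : linear (fun f : hom x y => fmap F (fmap E f)).
Proof. by move=> a u v; rewrite !fmap_linear. Qed.

Lemma compf_1 (x : B) : fmap F (fmap E (idm x)) = idm (F (E x)).
Proof. by rewrite !fmap1. Qed.

Lemma compf_M (x y z : B) (g : hom y z) (f : hom x y) :
  fmap F (fmap E (g ∘ f)) = fmap F (fmap E g) ∘ fmap F (fmap E f).
Proof. by rewrite !fmapM. Qed.

Definition compf : linfunctor B D :=
  LinFunctor compf_linear compf_1 compf_M.

End FunctorComposition.

Definition equivalence_of_categories (k : comPzRingType) (C D : lincat k)
    (E : linfunctor C D) : Prop :=
  exists F : linfunctor D C,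
    (exists eta : nattrans (compf F E) (idfun_lin C), is_natiso eta) /\
    (exists eps : nattrans (compf E F) (idfun_lin D), is_natiso eps).

(** * G-categories and G-equivariant functors *)

Record linaut (k : comPzRingType) (C : lincat k) : Type := LinAut {
  linaut_functor :> linfunctor C C;
  linautP : exists F : linfunctor C C,
    compf F linaut_functor = idfun_lin C /\
    compf linaut_functor F = idfun_lin C
}.

(* act is a group homomorphism G -> Aut(C), whence act 1 = id.                *)
Record gcat (k : comPzRingType) (G : groupType) : Type := GCategory {
  gcat_cat :> lincat k;
  act : G -> linaut gcat_cat;
  actM : forall b a : G,
    act (b * a)%g = compf (act b) (act a) :> linfunctor gcat_cat gcat_cat
}.

(* A morphism together with its domain and codomain: Arrow f = Arrow g says   *)
(* that f and g are the same morphism of C when their domains and codomains   *)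
(* are equal but not convertible.                                             *)
Record arrow (k : comPzRingType) (C : lincat k) : Type := MkArrow {
  dom : C;
  cod : C;
  mor : hom dom cod
}.
Definition Arrow (k : comPzRingType) (C : lincat k) (x y : C) (f : hom x y)
  : arrow C := MkArrow f.

(* rhoM is the equation rho_(ba) = (rho_b A_a) (A_b rho_a), at each object;   *)
(* its sides go between the equal objects A_(ba) E x = A_b (A_a (E x)) and    *)
(* E (A_(ba) x) = E (A_b (A_a x)).                                            *)
Record gfunctor (k : comPzRingType) (G : groupType) (C D : gcat k G) : Type :=
  GFunctor {
  gfun :> linfunctor C D;
  rho : forall a : G, nattrans (compf (act D a) gfun) (compf gfun (act C a));
  rho_iso : forall a : G, is_natiso (rho a);
  rhoM : forall (b a : G) (x : C),
    Arrow (rho (b * a)%g x) = Arrow (rho b (act C a x) ∘ fmap (act D b) (rho a x))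
}.

Record gtrans (k : comPzRingType) (G : groupType) (C D : gcat k G)
    (E F : gfunctor C D) : Type := GTrans {
  gtr :> nattrans E F;
  gtrP : forall (a : G) (x : C),
    gtr (act C a x) ∘ rho E a x = rho F a x ∘ fmap (act D a) (gtr x)
}.

Lemma Arrow_inj (k : comPzRingType) (C : lincat k) (x y : C) (f g : hom x y) :
  Arrow f = Arrow g -> f = g.
Proof.
have castP (p q : arrow C) (e : p = q) :
    exists (e1 : dom p = dom q) (e2 : cod p = cod q),
      eq_rect _ (fun u => hom u (cod q))
        (eq_rect _ (fun v => hom (dom p) v) (mor p) _ e2) _ e1 = mor q.
  by case: q / e; exists erefl, erefl.
move=> /castP[/= e1 [e2 <-]].
by rewrite (Prop_irrelevance e1 erefl) (Prop_irrelevance e2 erefl).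
Qed.

Lemma Arrow_comp (k : comPzRingType) (C : lincat k) (x y z x' y' z' : C)
    (g : hom y z) (f : hom x y) (g' : hom y' z') (f' : hom x' y') :
  Arrow g = Arrow g' -> Arrow f = Arrow f' -> Arrow (g ∘ f) = Arrow (g' ∘ f').
Proof.
move=> eg ef.
have ex : x = x' by case: ef.
have ey : y = y' by case: ef.
have ez : z = z' by case: eg.
subst x' y' z'.
by rewrite (Arrow_inj eg) (Arrow_inj ef).
Qed.

Lemma Arrow_fmap (k : comPzRingType) (C D : lincat k) (F : linfunctor C D)
    (x y x' y' : C) (f : hom x y) (f' : hom x' y') :
  Arrow f = Arrow f' -> Arrow (fmap F f) = Arrow (fmap F f').
Proof.
by move=> /(congr1 (fun p : arrow C => Arrow (fmap F (mor p)))).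
Qed.

Lemma is_iso_comp (k : comPzRingType) (C : lincat k) (x y z : C)
    (g : hom y z) (f : hom x y) : is_iso g -> is_iso f -> is_iso (g ∘ f).
Proof.
move=> [g' [g'g gg']] [f' [f'f ff']]; exists (f' ∘ g'); split.
  by rewrite compA -(compA f') g'g compm1.
by rewrite compA -(compA g) ff' compm1.
Qed.

Lemma is_iso_fmap (k : comPzRingType) (C D : lincat k) (F : linfunctor C D)
    (x y : C) (f : hom x y) : is_iso f -> is_iso (fmap F f).
Proof.
by move=> [g [gf fg]]; exists (fmap F g); rewrite -!fmapM gf fg !fmap1.
Qed.

Section IdentityGFunctor.
Context (k : comPzRingType) (G : groupType) (C : gcat k G).

Lemma idg_rho_nat (a : G) (x y : C) (f : hom x y) :
  idm (act C a y) ∘ fmap (act C a) f = fmap (act C a) f ∘ idm (act C a x).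
Proof. by rewrite comp1m compm1. Qed.

Definition idg_rho (a : G) :
    nattrans (compf (act C a) (idfun_lin C)) (compf (idfun_lin C) (act C a)) :=
  @NatTrans k C C (compf (act C a) (idfun_lin C)) (compf (idfun_lin C) (act C a))
    (fun x => idm (act C a x)) (idg_rho_nat a).

Lemma idg_rho_iso a : is_natiso (idg_rho a).
Proof. by move=> x; exists (idm (act C a x)); rewrite /= comp1m. Qed.

Lemma idg_rhoM (b a : G) (x : C) :
  Arrow (idg_rho (b * a)%g x) =
  Arrow (idg_rho b (act C a x) ∘ fmap (act C b) (idg_rho a x)).
Proof.
rewrite /= fmap1 comp1m.
by rewrite (congr1 (fun F : linfunctor C C => F x) (actM C b a)).
Qed.

Definition idg : gfunctor C C := GFunctor idg_rho_iso idg_rhoM.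

End IdentityGFunctor.

Section CompositeGFunctor.
Context (k : comPzRingType) (G : groupType) (B C D : gcat k G).
Context (F : gfunctor C D) (E : gfunctor B C).

Definition compg_cmp (a : G) (x : B) :
    hom (act D a (F (E x))) (F (E (act B a x))) :=
  fmap F (rho E a x) ∘ rho F a (E x).

Lemma compg_cmp_nat (a : G) (x y : B) (f : hom x y) :
  compg_cmp a y ∘ fmap (act D a) (fmap F (fmap E f)) =
  fmap F (fmap E (fmap (act B a) f)) ∘ compg_cmp a x.
Proof.
rewrite /compg_cmp -compA (cmp_nat (rho F a) (fmap E f)) /= !compA.
by rewrite -!fmapM (cmp_nat (rho E a) f).
Qed.

Definition compg_rho (a : G) :
    nattrans (compf (act D a) (compf F E)) (compf (compf F E) (act B a)) :=
  @NatTrans k B D (compf (act D a) (compf F E)) (compf (compf F E) (act B a))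
    (compg_cmp a) (compg_cmp_nat a).

Lemma compg_rho_iso a : is_natiso (compg_rho a).
Proof.
move=> x; apply: is_iso_comp; last exact: rho_iso.
by apply: is_iso_fmap; exact: rho_iso.
Qed.

Lemma compg_rhoM (b a : G) (x : B) :
  Arrow (compg_rho (b * a)%g x) =
  Arrow (compg_rho b (act B a x) ∘ fmap (act D b) (compg_rho a x)).
Proof.
rewrite /= (Arrow_comp (Arrow_fmap F (rhoM E b a x)) (rhoM F b a (E x))).
congr Arrow; rewrite !fmapM -!compA; congr (_ ∘ _).
rewrite !compA; congr (_ ∘ _).
exact/esym/(cmp_nat (rho F b) (rho E a x)).
Qed.

Definition compg : gfunctor B D := GFunctor compg_rho_iso compg_rhoM.

End CompositeGFunctor.

Section VerticalComposition.
Context (k : comPzRingType) (G : groupType) (C D : gcat k G).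

Lemma idt_nat (E : gfunctor C D) (x y : C) (f : hom x y) :
  idm (E y) ∘ fmap E f = fmap E f ∘ idm (E x).
Proof. by rewrite comp1m compm1. Qed.

Lemma idtP (E : gfunctor C D) (a : G) (x : C) :
  idm (E (act C a x)) ∘ rho E a x = rho E a x ∘ fmap (act D a) (idm (E x)).
Proof. by rewrite fmap1 comp1m compm1. Qed.

Definition idt (E : gfunctor C D) : gtrans E E :=
  @GTrans k G C D E E (NatTrans (idt_nat E)) (@idtP E).

Context (E F H : gfunctor C D) (b : gtrans F H) (a : gtrans E F).

Lemma vcompt_nat (x y : C) (f : hom x y) :
  (b y ∘ a y) ∘ fmap E f = fmap H f ∘ (b x ∘ a x).
Proof. by rewrite -compA cmp_nat !compA cmp_nat. Qed.

Lemma vcomptP (g : G) (x : C) :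
  (b (act C g x) ∘ a (act C g x)) ∘ rho E g x =
  rho H g x ∘ fmap (act D g) (b x ∘ a x).
Proof. by rewrite fmapM -compA gtrP !compA gtrP. Qed.

Definition vcompt : gtrans E H :=
  @GTrans k G C D E H (NatTrans vcompt_nat) vcomptP.

End VerticalComposition.

Section HorizontalComposition.
Context (k : comPzRingType) (G : groupType) (B C D : gcat k G).
Context (E E' : gfunctor B C) (F F' : gfunctor C D).
Context (b : gtrans F F') (a : gtrans E E').

Definition hcompt_cmp (x : B) : hom (F (E x)) (F' (E' x)) :=
  b (E' x) ∘ fmap F (a x).

Lemma hcompt_nat (x y : B) (f : hom x y) :
  hcompt_cmp y ∘ fmap F (fmap E f) = fmap F' (fmap E' f) ∘ hcompt_cmp x.
Proof.
by rewrite /hcompt_cmp -compA -fmapM (cmp_nat a) fmapM !compA cmp_nat.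
Qed.

Lemma hcomptP (g : G) (x : B) :
  hcompt_cmp (act B g x) ∘ compg_cmp F E g x =
  compg_cmp F' E' g x ∘ fmap (act D g) (hcompt_cmp x).
Proof.
rewrite /hcompt_cmp /compg_cmp fmapM -!compA.
rewrite (compA (fmap F _) (fmap F _)) -fmapM gtrP fmapM -(compA (fmap F _)).
have /= <- := cmp_nat (rho F g) (a x).
rewrite compA cmp_nat -!compA; congr (_ ∘ _).
by rewrite !compA gtrP.
Qed.

Definition hcompt : gtrans (compg F E) (compg F' E') :=
  @GTrans k G B D (compg F E) (compg F' E')
    (@NatTrans k B D (compg F E) (compg F' E') hcompt_cmp hcompt_nat) hcomptP.

End HorizontalComposition.

(** * The 2-category of small G-categories *)

Section Extensionality.
Context (k : comPzRingType) (G : groupType) (C D : gcat k G).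

Lemma nattrans_eq (A B : lincat k) (E F : linfunctor A B) (a b : nattrans E F) :
  (forall x, a x = b x) -> a = b.
Proof.
case: a b => [a an] [b bn] /= ab.
have {}ab : a = b by apply: functional_extensionality_dep.
by subst b; rewrite (Prop_irrelevance an bn).
Qed.

Lemma gtrans_eq (E F : gfunctor C D) (a b : gtrans E F) :
  (forall x, a x = b x) -> a = b.
Proof.
case: a b => [a an] [b bn] /= /nattrans_eq ab.
by subst b; rewrite (Prop_irrelevance an bn).
Qed.

Lemma gfunctor_eq (E F : gfunctor C D) :
    E = F :> linfunctor C D ->
    (forall a x, Arrow (rho E a x) = Arrow (rho F a x)) ->
  E = F.
Proof.
case: E F => [E r ri rM] [F s si sM] /= EF rs; subst F.
have {}rs : r = s.
  apply: functional_extensionality_dep => a; apply: nattrans_eq => x.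
  exact: Arrow_inj (rs a x).
by subst s; rewrite (Prop_irrelevance ri si) (Prop_irrelevance rM sM).
Qed.

Lemma cell2_eq (E F E' F' : gfunctor C D) (a : gtrans E F) (b : gtrans E' F') :
    E = E' -> F = F' -> (forall x, Arrow (a x) = Arrow (b x)) ->
  Cell2 a = Cell2 b.
Proof.
move=> EE' FF' ab; subst E' F'.
by congr Cell2; apply: gtrans_eq => x; apply: Arrow_inj (ab x).
Qed.

End Extensionality.

Lemma compfA (k : comPzRingType) (A B C D : lincat k) (H : linfunctor C D)
    (F : linfunctor B C) (E : linfunctor A B) :
  compf H (compf F E) = compf (compf H F) E.
Proof. by congr LinFunctor; apply: Prop_irrelevance. Qed.

Lemma compf1l (k : comPzRingType) (C D : lincat k) (E : linfunctor C D) :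
  compf (idfun_lin D) E = E.
Proof. by case: E => *; congr LinFunctor; apply: Prop_irrelevance. Qed.

Lemma compf1r (k : comPzRingType) (C D : lincat k) (E : linfunctor C D) :
  compf E (idfun_lin C) = E.
Proof. by case: E => *; congr LinFunctor; apply: Prop_irrelevance. Qed.

Section GCatLaws.
Context (k : comPzRingType) (G : groupType).
Implicit Types A B C D : gcat k G.

Lemma compgA A B C D (H : gfunctor C D) (F : gfunctor B C) (E : gfunctor A B) :
  compg H (compg F E) = compg (compg H F) E.
Proof.
apply: gfunctor_eq => [|a x]; first exact: compfA.
by rewrite /= /compg_cmp /= fmapM compA.
Qed.

Lemma compg1l C D (E : gfunctor C D) : compg (idg D) E = E.
Proof.
apply: gfunctor_eq => [|a x]; first exact: compf1l.
by rewrite /= /compg_cmp /= compm1.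
Qed.

Lemma compg1r C D (E : gfunctor C D) : compg E (idg C) = E.
Proof.
apply: gfunctor_eq => [|a x]; first exact: compf1r.
by rewrite /= /compg_cmp /= fmap1 comp1m.
Qed.

Lemma vcomptA C D (E F H K : gfunctor C D)
    (c : gtrans H K) (b : gtrans F H) (a : gtrans E F) :
  vcompt c (vcompt b a) = vcompt (vcompt c b) a.
Proof. by apply: gtrans_eq => x /=; rewrite compA. Qed.

Lemma vcompt1l C D (E F : gfunctor C D) (a : gtrans E F) :
  vcompt (idt F) a = a.
Proof. by apply: gtrans_eq => x /=; rewrite comp1m. Qed.

Lemma vcompt1r C D (E F : gfunctor C D) (a : gtrans E F) :
  vcompt a (idt E) = a.
Proof. by apply: gtrans_eq => x /=; rewrite compm1. Qed.

Lemma hcompt_id B C D (E : gfunctor B C) (F : gfunctor C D) :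
  hcompt (idt F) (idt E) = idt (compg F E).
Proof. by apply: gtrans_eq => x /=; rewrite /hcompt_cmp /= fmap1 comp1m. Qed.

Lemma hcompt_vcompt B C D (E E' E'' : gfunctor B C) (F F' F'' : gfunctor C D)
    (b' : gtrans F' F'') (b : gtrans F F')
    (a' : gtrans E' E'') (a : gtrans E E') :
  hcompt (vcompt b' b) (vcompt a' a) = vcompt (hcompt b' a') (hcompt b a).
Proof.
apply: gtrans_eq => x /=; rewrite /hcompt_cmp /= fmapM -!compA; congr (_ ∘ _).
by rewrite !compA cmp_nat.
Qed.

Lemma hcomptA A B C D (E E' : gfunctor A B) (F F' : gfunctor B C)
    (H H' : gfunctor C D) (c : gtrans H H') (b : gtrans F F')
    (a : gtrans E E') :
  Cell2 (hcompt c (hcompt b a)) = Cell2 (hcompt (hcompt c b) a).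
Proof.
apply: cell2_eq => [||x]; [exact: compgA | exact: compgA |].
by rewrite /= /hcompt_cmp /= fmapM compA.
Qed.

Lemma hcompt1l C D (E E' : gfunctor C D) (a : gtrans E E') :
  Cell2 (hcompt (idt (idg D)) a) = Cell2 a.
Proof.
apply: cell2_eq => [||x]; [exact: compg1l | exact: compg1l |].
by rewrite /= /hcompt_cmp /= comp1m.
Qed.

Lemma hcompt1r C D (E E' : gfunctor C D) (a : gtrans E E') :
  Cell2 (hcompt a (idt (idg C))) = Cell2 a.
Proof.
apply: cell2_eq => [||x]; [exact: compg1r | exact: compg1r |].
by rewrite /= /hcompt_cmp /= fmap1 compm1.
Qed.

End GCatLaws.

Definition GCat (k : comPzRingType) (G : groupType) : twocat :=
  @TwoCat (gcat k G) (@gfunctor k G) (@gtrans k G)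
    (@idg k G) (@compg k G) (@idt k G) (@vcompt k G) (@hcompt k G)
    (@vcomptA k G) (@vcompt1l k G) (@vcompt1r k G)
    (@hcompt_id k G) (@hcompt_vcompt k G)
    (@compgA k G) (@compg1l k G) (@compg1r k G)
    (@hcomptA k G) (@hcompt1l k G) (@hcompt1r k G).

(* Main.v *)
From mathcomp Require Import all_boot all_algebra.
From mathcomp Require Import boolp.
Require Import Defs.

(** An equivalence in [G-Cat] forgets to an equivalence of categories, hence is
    fully faithful and dense. Conversely, if E is fully faithful and dense,
    choose isomorphisms s_y : E (F y) -> y; fully faithfulness makes F a functor
    and s : E F => id natural. Requiring s to be equivariant forces
    E (rho^F_a y) = s^-1 ∘ A_a s ∘ (rho^E_a)^-1, which defines rho^F by
    fully faithfulness, and faithfulness of E reduces every remaining identity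
    (the cocycle condition for rho^F, and naturality and equivariance of the
    unique eta : F E => id with E eta = s E) to the corresponding property of
    rho^E and s. *)

Set Implicit Arguments.
Unset Strict Implicit.
Unset Printing Implicit Defensive.

Import GRing.Theory.
Local Open Scope ring_scope.
Local Open Scope lincat_scope.

(** * Cancellation and chosen inverses of isomorphisms *)

Section Isomorphisms.
Context (k : comPzRingType) (C : lincat k).

Lemma iso_monic (x y z : C) (g : hom y z) (f f' : hom x y) :
  is_iso g -> g ∘ f = g ∘ f' -> f = f'.
Proof.
move=> [h [hg _]] /(congr1 (comp h)).
by rewrite !compA hg !comp1m.
Qed.

Lemma iso_epic (x y z : C) (g g' : hom y z) (f : hom x y) :
  is_iso f -> g ∘ f = g' ∘ f -> g = g'.
Proof.
move=> [h [_ fh]] /(congr1 (fun u => u ∘ h)).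
by rewrite -!compA fh !compm1.
Qed.

Definition iso_inv (x y : C) (f : hom x y) (fi : is_iso f) : hom y x :=
  projT1 (cid fi).

Lemma iso_invl (x y : C) (f : hom x y) (fi : is_iso f) :
  iso_inv fi ∘ f = idm x.
Proof. by rewrite /iso_inv; case: cid => g []. Qed.

Lemma iso_invr (x y : C) (f : hom x y) (fi : is_iso f) :
  f ∘ iso_inv fi = idm y.
Proof. by rewrite /iso_inv; case: cid => g []. Qed.

Lemma iso_inv_iso (x y : C) (f : hom x y) (fi : is_iso f) :
  is_iso (iso_inv fi).
Proof. by exists f; rewrite iso_invl iso_invr. Qed.

End Isomorphisms.

(** * Invertible 2-morphisms of [GCat] versus natural isomorphisms *)

Section InvertibleGTrans.
Context (k : comPzRingType) (G : groupType) (C D : gcat k G).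
Context (E F : gfunctor C D).

Section Inverse.
Context (eta : gtrans E F) (etai : is_natiso eta).

Lemma gtrans_inv_nat (x y : C) (f : hom x y) :
  iso_inv (etai y) ∘ fmap F f = fmap E f ∘ iso_inv (etai x).
Proof.
apply: (iso_epic (etai x)); apply: (iso_monic (etai y)).
rewrite -!compA iso_invl compm1 -(cmp_nat eta) (compA (eta y)) iso_invr.
by rewrite comp1m.
Qed.

Lemma gtrans_invP (a : G) (x : C) :
  iso_inv (etai (act C a x)) ∘ rho F a x =
  rho E a x ∘ fmap (act D a) (iso_inv (etai x)).
Proof.
apply: (iso_monic (etai _)).
rewrite !compA iso_invr comp1m gtrP -compA /= -fmapM iso_invr fmap1.
by rewrite compm1.
Qed.

Definition gtrans_inv : gtrans F E :=
  @GTrans k G C D F E (NatTrans gtrans_inv_nat) gtrans_invP.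

End Inverse.

(** The pointwise inverses form a 2-morphism: cancelling components of [eta] turns their naturality
    and equivariance into those of [eta]. *)
Lemma natiso_iso1 (eta : gtrans E F) :
  is_natiso eta -> @iso1 (GCat k G) C D E F.
Proof.
move=> etai; exists eta, (gtrans_inv etai).
by split; apply: gtrans_eq => x /=; rewrite ?iso_invl ?iso_invr.
Qed.

Lemma iso1_natiso : @iso1 (GCat k G) C D E F ->
  exists eta : nattrans E F, is_natiso eta.
Proof.
move=> [a [b [/= ba ab]]]; exists a => x; exists (b x).
have /= := congr1 (fun c : gtrans E E => c x) ba.
by have /= := congr1 (fun c : gtrans F F => c x) ab.
Qed.

End InvertibleGTrans.

(** * From equivalences to full faithfulness and density *)

Lemma gequivalence_equivalence (k : comPzRingType) (G : groupType)
    (C D : gcat k G) (E : gfunctor C D) :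
  @is_equivalence (GCat k G) C D E -> equivalence_of_categories E.
Proof.
move=> [F [FE EF]]; exists F.
by split; [exact: iso1_natiso FE | exact: iso1_natiso EF].
Qed.

(** Naturality gives [eta y ∘ fmap F (fmap E f) = f ∘ eta x], so [fmap E f] determines [f] once
    [eta x] is cancelled. *)
Lemma faithful_of_retraction (k : comPzRingType) (C D : lincat k)
    (E : linfunctor C D) (F : linfunctor D C)
    (eta : nattrans (compf F E) (idfun_lin C)) :
  is_natiso eta -> forall x y : C, injective (@fmap k C D E x y).
Proof.
move=> etai x y f f' Eff'; apply: (iso_epic (etai x)).
have /= <- := cmp_nat eta f; have /= <- := cmp_nat eta f'.
by rewrite Eff'.
Qed.

Lemma equivalence_ff_dense (k : comPzRingType) (C D : lincat k)
    (E : linfunctor C D) :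
  equivalence_of_categories E -> fully_faithful E /\ dense E.
Proof.
move=> [F [[eta etai] [eps epsi]]]; split; last first.
  by move=> y; exists (F y), (eps y); exact: epsi.
move=> x y.
(* The preimage of [h] is [fmap F h] conjugated by [eta]. *)
exists (fun h => eta y ∘ fmap F h ∘ iso_inv (etai x)) => [f|h].
  have /= -> := cmp_nat eta f.
  by rewrite -compA iso_invr compm1.
(* The roles are exchanged here: [eps] makes [F] faithful, so the identity may be checked after
   applying [F]. *)
apply: (faithful_of_retraction epsi); apply: (iso_monic (etai y)).
have /= -> := cmp_nat eta (eta y ∘ fmap F h ∘ iso_inv (etai x)).
by rewrite -compA iso_invl compm1.
Qed.

(** * Comparing morphisms between equal but not convertible objects *)

(** Substituting the object equalities reduces this to cancelling [r] and using faithfulness. It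
    serves the cocycle condition, where [r] and [r'] are the two sides of [rhoM]. *)
Lemma Arrow_fmap_inj (k : comPzRingType) (C D : lincat k) (E : linfunctor C D)
    (x y x' y' : C) (f : hom x y) (f' : hom x' y') (u u' : D)
    (r : hom u (E x)) (r' : hom u' (E x')) :
    (forall v w : C, injective (@fmap k C D E v w)) ->
    x = x' -> y = y' -> is_iso r -> Arrow r = Arrow r' ->
    Arrow (fmap E f ∘ r) = Arrow (fmap E f' ∘ r') ->
  Arrow f = Arrow f'.
Proof.
move=> Einj ex ey ri er; subst x' y'.
have eu : u = u' by case: er.
subst u'; rewrite -(Arrow_inj er) => /Arrow_inj /(iso_epic ri) /Einj.
by move=> ->.
Qed.

Lemma act_objM (k : comPzRingType) (G : groupType) (B : gcat k G)
    (b a : G) (x : B) :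
  act B (b * a)%g x = act B b (act B a x).
Proof. exact: (congr1 (fun F : linfunctor B B => F x) (actM B b a)). Qed.

Lemma act_mapM (k : comPzRingType) (G : groupType) (B : gcat k G)
    (b a : G) (x y : B) (f : hom x y) :
  Arrow (fmap (act B (b * a)%g) f) =
  Arrow (fmap (act B b) (fmap (act B a) f)).
Proof.
exact: (congr1 (fun F : linfunctor B B => Arrow (fmap F f)) (actM B b a)).
Qed.

(** * The equivariant quasi-inverse, its counit and its unit *)

Section QuasiInverse.
Context (k : comPzRingType) (G : groupType) (C D : gcat k G).
Context (E : gfunctor C D) (Eff : fully_faithful E) (Ed : dense E).

Lemma ff_inj (x y : C) : injective (@fmap k C D E x y).
Proof. exact: bij_inj (Eff x y). Qed.

Lemma ff_surj (x y : C) (h : hom (E x) (E y)) : exists f, fmap E f = h.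
Proof. by have [g _ gK] := Eff x y; exists (g h). Qed.

Definition ff_pre (x y : C) (h : hom (E x) (E y)) : hom x y :=
  projT1 (cid (ff_surj h)).

Lemma ff_preK (x y : C) (h : hom (E x) (E y)) : fmap E (ff_pre h) = h.
Proof. by rewrite /ff_pre; case: cid. Qed.

Lemma ff_pre_iso (x y : C) (h : hom (E x) (E y)) :
  is_iso h -> is_iso (ff_pre h).
Proof.
move=> [g [gh hg]]; exists (ff_pre g).
by split; apply: ff_inj; rewrite fmapM !ff_preK fmap1.
Qed.

Definition qinv_obj (y : D) : C := projT1 (cid (Ed y)).

Definition counit_cmp (y : D) : hom (E (qinv_obj y)) y :=
  projT1 (cid (projT2 (cid (Ed y)))).

Lemma counit_iso (y : D) : is_iso (counit_cmp y).
Proof. exact: projT2 (cid (projT2 (cid (Ed y)))). Qed.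

Definition qinv_map (x y : D) (f : hom x y) : hom (qinv_obj x) (qinv_obj y) :=
  ff_pre (iso_inv (counit_iso y) ∘ f ∘ counit_cmp x).

Lemma counit_nat (x y : D) (f : hom x y) :
  counit_cmp y ∘ fmap E (qinv_map f) = f ∘ counit_cmp x.
Proof. by rewrite ff_preK !compA iso_invr comp1m. Qed.

Lemma qinv_map_linear (x y : D) : linear (@qinv_map x y).
Proof.
move=> c f g; apply: ff_inj.
by rewrite fmap_linear !ff_preK comp_linearr comp_linearl.
Qed.

Lemma qinv_map1 (x : D) : qinv_map (idm x) = idm (qinv_obj x).
Proof. by apply: ff_inj; rewrite ff_preK compm1 iso_invl fmap1. Qed.

Lemma qinv_mapM (x y z : D) (g : hom y z) (f : hom x y) :
  qinv_map (g ∘ f) = qinv_map g ∘ qinv_map f.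
Proof.
apply: ff_inj; apply: (iso_monic (counit_iso z)).
by rewrite counit_nat fmapM compA counit_nat -!compA counit_nat.
Qed.

Definition qinv_fun : linfunctor D C :=
  LinFunctor qinv_map_linear qinv_map1 qinv_mapM.

Definition qinv_rho_cmp (a : G) (y : D) :
    hom (act C a (qinv_obj y)) (qinv_obj (act D a y)) :=
  ff_pre (iso_inv (counit_iso (act D a y)) ∘ fmap (act D a) (counit_cmp y)
          ∘ iso_inv (rho_iso E a (qinv_obj y))).

Lemma qinv_rhoE (a : G) (y : D) :
  fmap E (qinv_rho_cmp a y) ∘ rho E a (qinv_obj y) =
  iso_inv (counit_iso (act D a y)) ∘ fmap (act D a) (counit_cmp y).
Proof. by rewrite ff_preK -!compA iso_invl compm1. Qed.

(** This is the equivariance of the counit, in the form that later rewrites use to eliminate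
    [qinv_rho_cmp]. *)
Lemma counit_rho (a : G) (y : D) :
  counit_cmp (act D a y) ∘
    (fmap E (qinv_rho_cmp a y) ∘ rho E a (qinv_obj y)) =
  fmap (act D a) (counit_cmp y).
Proof.
by rewrite qinv_rhoE compA iso_invr comp1m.
Qed.

Lemma qinv_rho_nat (a : G) (x y : D) (f : hom x y) :
  qinv_rho_cmp a y ∘ fmap (act C a) (qinv_map f) =
  qinv_map (fmap (act D a) f) ∘ qinv_rho_cmp a x.
Proof.
(* Between [rho] and the counit, both sides become the image under [act D a] of
   [f ∘ counit_cmp x]. *)
apply: ff_inj; apply: (iso_epic (rho_iso E a (qinv_obj x))).
apply: (iso_monic (counit_iso _)).
rewrite !fmapM -!compA.
have /= <- := cmp_nat (rho E a) (qinv_map f).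
rewrite (compA (fmap E _)) compA counit_rho -fmapM counit_nat.
by rewrite (compA (counit_cmp _)) counit_nat -compA counit_rho fmapM.
Qed.

Definition qinv_rho (a : G) :
    nattrans (compf (act C a) qinv_fun) (compf qinv_fun (act D a)) :=
  @NatTrans k D C (compf (act C a) qinv_fun) (compf qinv_fun (act D a))
    (qinv_rho_cmp a) (@qinv_rho_nat a).

Lemma qinv_rho_iso (a : G) : is_natiso (qinv_rho a).
Proof.
move=> y; apply: ff_pre_iso; apply: is_iso_comp; last exact: iso_inv_iso.
apply: is_iso_comp; first exact: iso_inv_iso.
exact/is_iso_fmap/counit_iso.
Qed.

Lemma qinv_rhoM (b a : G) (y : D) :
  Arrow (qinv_rho (b * a)%g y) =
  Arrow (qinv_rho b (act D a y) ∘ fmap (act C b) (qinv_rho a y)).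
Proof.
apply: (@Arrow_fmap_inj _ _ _ E _ _ _ _ _ _ _ _ _ _ ff_inj _ _
  (rho_iso E (b * a)%g (qinv_obj y)) (rhoM E b a (qinv_obj y))).
- exact: act_objM.
- by rewrite /= act_objM.
rewrite /= qinv_rhoE.
(* Naturality of [rho E b] moves [qinv_rho_cmp a y] under [act D b]; [counit_rho] then applies for
   [b], and for [a] inside [act D b]. What remains is functoriality of the action on
   [counit_cmp y]. *)
have -> : fmap E (qinv_rho_cmp b (act D a y) ∘
              fmap (act C b) (qinv_rho_cmp a y)) ∘
    (rho E b (act C a (qinv_obj y)) ∘
     fmap (act D b) (rho E a (qinv_obj y))) =
    iso_inv (counit_iso (act D b (act D a y))) ∘
    fmap (act D b) (fmap (act D a) (counit_cmp y)).
  apply: (iso_monic (counit_iso _)).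
  rewrite [RHS]compA iso_invr comp1m fmapM -!compA (compA (fmap E (fmap _ _))).
  have /= <- := cmp_nat (rho E b) (qinv_rho_cmp a y).
  rewrite -compA -fmapM (compA (fmap E _)) compA counit_rho.
  by rewrite -fmapM counit_rho.
apply: Arrow_comp; last exact: act_mapM.
by rewrite act_objM.
Qed.

Definition qinv : gfunctor D C := GFunctor qinv_rho_iso qinv_rhoM.

Lemma counitP (a : G) (y : D) :
  counit_cmp (act D a y) ∘ rho (compg E qinv) a y =
  rho (idg D) a y ∘ fmap (act D a) (counit_cmp y).
Proof. by rewrite /= /compg_cmp /= counit_rho comp1m. Qed.

Definition counit_gtrans : gtrans (compg E qinv) (idg D) :=
  @GTrans k G D D (compg E qinv) (idg D)
    (@NatTrans k D D (compg E qinv) (idg D) counit_cmp counit_nat) counitP.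

Definition unit_cmp (x : C) : hom (qinv_obj (E x)) x :=
  ff_pre (counit_cmp (E x)).

Lemma unit_nat (x y : C) (f : hom x y) :
  unit_cmp y ∘ qinv_map (fmap E f) = f ∘ unit_cmp x.
Proof. by apply: ff_inj; rewrite !fmapM !(ff_preK (counit_cmp _)) counit_nat. Qed.

Lemma unitP (a : G) (x : C) :
  unit_cmp (act C a x) ∘ rho (compg qinv E) a x =
  rho (idg C) a x ∘ fmap (act C a) (unit_cmp x).
Proof.
rewrite /= /compg_cmp /= comp1m.
(* Both sides become [rho E a x ∘ fmap (act D a) (counit_cmp (E x))], by naturality of [rho] on the
   right and of the counit on the left. *)
apply: ff_inj; apply: (iso_epic (rho_iso E a (qinv_obj (E x)))).
have /= <- := cmp_nat (rho E a) (unit_cmp x).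
rewrite !fmapM !(ff_preK (counit_cmp _)) compA counit_nat -!compA.
by rewrite counit_rho.
Qed.

Definition unit_gtrans : gtrans (compg qinv E) (idg C) :=
  @GTrans k G C C (compg qinv E) (idg C)
    (@NatTrans k C C (compg qinv E) (idg C) unit_cmp unit_nat) unitP.

Lemma ff_dense_gequivalence : @is_equivalence (GCat k G) C D E.
Proof.
exists qinv; split; last exact: (@natiso_iso1 _ _ _ _ _ _ counit_gtrans counit_iso).
apply: (@natiso_iso1 _ _ _ _ _ _ unit_gtrans) => x.
exact/ff_pre_iso/counit_iso.
Qed.

End QuasiInverse.

Theorem theorem9p1 (k : comPzRingType) (G : groupType) (C C' : gcat k G)
    (E : gfunctor C C') :
  (@is_equivalence (GCat k G) C C' E <-> fully_faithful E /\ dense E) /\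
  (@is_equivalence (GCat k G) C C' E <-> equivalence_of_categories E).
Proof.
split; split.
- by move=> /gequivalence_equivalence /equivalence_ff_dense.
- by move=> [Eff Ed]; exact: ff_dense_gequivalence.
- exact: gequivalence_equivalence.
- by move=> /equivalence_ff_dense [Eff Ed]; exact: ff_dense_gequivalence.
Qed.
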